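(* Let $K,L\in\mathcal F_0^+$ and let $i,j,k\in\mathbb R$ satisfy $i<j<k$. Then, for $-n<p\le0$ and $\alpha=1,2$, $$G_{p,j}^{(\alpha)}(K,L)^{k-i}\le G_{p,i}^{(\alpha)}(K,L)^{k-j}\,G_{p,k}^{(\alpha)}(K,L)^{j-i}.$$ In particular, letting $L=B_2^n$, $$G_{p,j}^{(\alpha)}(K)^{k-i}\le G_{p,i}^{(\alpha)}(K)^{k-j}\,G_{p,k}^{(\alpha)}(K)^{j-i}.$$
   Context: Notation in $\mathbb R^n$: $S^{n-1}$ is the unit sphere with spherical measure $\sigma$, $B_2^n$ the Euclidean unit ball, $|\cdot|$ volume. $\mathcal K_0$ is the set of convex bodies (compact convex sets) containing the origin in their interior. For $K\in\mathcal K_0$: $h_K(u)=\max_{x\in K}\langle x,u\rangle$ and $K^\circ=\{x:\langle x,y\rangle\le1\ \forall y\in K\}$. $\mathcal F_0^+$ is the set of $K\in\mathcal K_0$ whose surface area measure $S(K,\cdot)$ is absolutely continuous with respect to $\sigma$ with continuous positive density $f_K$ (curvature function); $f_p(K,u)=h_K(u)^{1-p}f_K(u)$. For $K,L\in\mathcal F_0^+$, $Q_1,Q_2\in\mathcal K_0$ and $i,p\in\mathbb R$, $$V_{p,i}(K,L;Q_1,Q_2)=\frac1n\int_{S^{n-1}}[h_{Q_1}^p(u)f_p(K,u)]^{\frac{n-i}n}[h_{Q_2}^p(u)f_p(L,u)]^{\frac in}d\sigma(u).$$ For $i\in\mathbb R$: $G_{0,i}^{(\alpha)}(K,L)=\int_{S^{n-1}}[h_Kf_K]^{\frac{n-i}n}[h_Lf_L]^{\frac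 in}d\sigma$ for $\alpha=1,2$; and for $-n<p<0$, $$G_{p,i}^{(1)}(K,L)=\sup_{Q\in\mathcal K_0}\Big\{n[V_{p,i}(K,L;Q,Q)]^{\frac n{n+p}}|Q^\circ|^{\frac p{n+p}}\Big\},$$ $$G_{p,i}^{(2)}(K,L)=\sup_{Q_1,Q_2\in\mathcal K_0}\Big\{n[V_{p,i}(K,L;Q_1,Q_2)]^{\frac n{n+p}}|Q_1^\circ|^{\frac{p(n-i)}{n(n+p)}}|Q_2^\circ|^{\frac{pi}{n(n+p)}}\Big\}$$ (suprema in $[0,+\infty]$). One writes $G_{p,i}^{(\alpha)}(K)=G_{p,i}^{(\alpha)}(K,B_2^n)$. *)

(* Defs.v *)
From HB Require Import structures.
From mathcomp Require Import all_boot all_order all_algebra.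
From mathcomp Require Import all_classical all_reals all_analysis.

Set Implicit Arguments.
Unset Strict Implicit.
Unset Printing Implicit Defensive.
Import Order.TTheory GRing.Theory Num.Theory.
Import numFieldNormedType.Exports.
Local Open Scope classical_set_scope.
Local Open Scope ring_scope.

(* R^n is 'rV[R]_n with its library topology and the Borel sigma-algebra of
   that topology.  The library norm on 'rV[R]_n is the sup norm, hence the
   separate Euclidean norm [enorm]. *)

HB.instance Definition _ (R : realType) (n : nat) :=
  @isMeasurable.Build (sigma_display (@open 'rV[R]_n)) 'rV[R]_n
    (@measurable _ (g_sigma_algebraType (@open 'rV[R]_n)))
    (@measurable0 _ (g_sigma_algebraType (@open 'rV[R]_n)))
    (@measurableC _ (g_sigma_algebraType (@open 'rV[R]_n)))
    (@bigcupT_measurable _ (g_sigma_algebraType (@open 'rV[R]_n))).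

Section euclidean.
Context (R : realType) (n : nat).
Implicit Types (x y u : 'rV[R]_n).

Definition edot x y : R := \sum_i x 0 i * y 0 i.

Definition enorm x : R := Num.sqrt (edot x x).

Definition eball : set 'rV[R]_n := [set x | enorm x <= 1].

Definition esphere : set 'rV[R]_n := [set u | enorm u = 1].

End euclidean.
Arguments eball {R n}.
Arguments esphere {R n}.

(* Lebesgue measure on R^n as an iterated integral of sections, that is, the
   n-fold product of [lebesgue_measure]; it is meaningful on Borel sets. *)
Fixpoint lebesgue_rV (R : realType) (n : nat) : set 'rV[R]_n -> \bar R :=
  match n with
  | 0 => dirac (0 : 'rV[R]_0)
  | m.+1 => fun A => (\int[lebesgue_measure]_(t in [set: R])
      lebesgue_rV [set x : 'rV[R]_m | A (row_mx (t%:M : 'rV[R]_1) x)])%E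
  end.

(* Spherical Lebesgue measure: n times the volume of the part of the unit ball
   lying on the rays through A. *)
Definition sphere_measure (R : realType) (n : nat) (A : set 'rV[R]_n) : \bar R :=
  (n%:R%:E * lebesgue_rV
     [set x : 'rV[R]_n | (0 < enorm x <= 1)%R /\ A ((enorm x)^-1 *: x)%R])%E.

Section hausdorff.
Context (R : realType) (n : nat).
Local Open Scope ereal_scope.

Definition ediam (C : set 'rV[R]_n) : \bar R :=
  ereal_sup [set r | exists x y, [/\ C x, C y & r = (enorm (x - y))%:E]].

(* The m-dimensional gauge omega_m (diam C / 2)^m, where omega_m is the volume
   of the m-dimensional unit ball.  The case C = set0 is separate because
   0 `^ 0 = 1. *)
Definition hausdorff_gauge (m : nat) (C : set 'rV[R]_n) : \bar R :=
  if C == set0 then 0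
  else lebesgue_rV (@eball R m) * ((2^-1)%:E * ediam C) `^ m%:R.

Definition hausdorff_pre (m : nat) (delta : R) (A : set 'rV[R]_n) : \bar R :=
  ereal_inf [set s | exists C : nat -> set 'rV[R]_n,
    [/\ A `<=` \bigcup_k C k,
        forall k, ediam (C k) <= delta%:E
      & s = \sum_(0 <= k <oo) hausdorff_gauge m (C k)]].

(* The limit as delta tends to 0 is a supremum, by monotonicity in delta. *)
Definition hausdorff_measure (m : nat) (A : set 'rV[R]_n) : \bar R :=
  ereal_sup [set hausdorff_pre m delta A | delta in [set d | (0 < d)%R]].

End hausdorff.

Section convex_bodies.
Context (R : realType) (n : nat).
Implicit Types (K L Q : set 'rV[R]_n) (u x y : 'rV[R]_n) (w : set 'rV[R]_n).

(* The class K_0. *)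
Definition convex_body0 K : Prop :=
  [/\ convex_set (K : set (convex_lmodType 'rV[R]_n)), compact K & K° 0].

Definition support_fun K u : R := sup [set edot x u | x in K].

Definition polar K : set 'rV[R]_n :=
  [set x | forall y, K y -> edot x y <= 1].

(* S(K, w): the (n-1)-dimensional Hausdorff measure of the set of (boundary)
   points of K having an outer unit normal in w. *)
Definition surface_area_measure K w : \bar R :=
  hausdorff_measure n.-1
    [set x | K x /\ exists2 u, w u & edot x u = support_fun K u].

(* f is a continuous positive density of S(K, .) with respect to the spherical
   measure; its values off the sphere are irrelevant. *)
Definition curvature_density K (f : 'rV[R]_n -> R) : Prop :=
  [/\ {within esphere, continuous f},
      forall u, esphere u -> 0 < f u
    & forall w, measurable w -> w `<=` esphere ->
        surface_area_measure K w = (\int[@sphere_measure R n]_(u in w) (f u)%:E)%E].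

(* The class F_0^+. *)
Definition convex_bodyF K : Prop :=
  convex_body0 K /\ exists f, curvature_density K f.

(* f_K: the density is unique on the sphere, and chosen among its extensions to
   R^n.  A set with no such density gets the junk value 1. *)
Definition curvature_fun K : 'rV[R]_n -> R :=
  xget (fun=> 1) [set f | curvature_density K f].

Definition p_curvature_fun (p : R) K u : R :=
  support_fun K u `^ (1 - p) * curvature_fun K u.

Local Open Scope ereal_scope.

Definition mixed_V (p i : R) K L Q1 Q2 : \bar R :=
  (n%:R^-1)%:E * \int[@sphere_measure R n]_(u in esphere)
    ((support_fun Q1 u `^ p * p_curvature_fun p K u) `^ ((n%:R - i) / n%:R) *
     (support_fun Q2 u `^ p * p_curvature_fun p L u) `^ (i / n%:R))%R%:E.

Definition G0 (i : R) K L : \bar R :=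
  \int[@sphere_measure R n]_(u in esphere)
    ((support_fun K u * curvature_fun K u) `^ ((n%:R - i) / n%:R) *
     (support_fun L u * curvature_fun L u) `^ (i / n%:R))%R%:E.

Definition G1 (p i : R) K L : \bar R :=
  if p == 0%R then G0 i K L else
  ereal_sup [set n%:R%:E * mixed_V p i K L Q Q `^ (n%:R / (n%:R + p)) *
                 lebesgue_rV (polar Q) `^ (p / (n%:R + p))
            | Q in convex_body0].

Definition G2 (p i : R) K L : \bar R :=
  if p == 0%R then G0 i K L else
  ereal_sup [set r | exists Q1 Q2, [/\ convex_body0 Q1, convex_body0 Q2 &
    r = n%:R%:E * mixed_V p i K L Q1 Q2 `^ (n%:R / (n%:R + p)) *
        lebesgue_rV (polar Q1) `^ (p * (n%:R - i) / (n%:R * (n%:R + p))) *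
        lebesgue_rV (polar Q2) `^ (p * i / (n%:R * (n%:R + p)))]].

End convex_bodies.

(* Main.v *)
(* The power means x `^ ((n - s) / n) * y `^ (s / n) are log-affine in s for
   positive x and y, so Hoelder's inequality makes their integral log-convex in
   s.  The factors that do not involve s, and the volumes of the polar bodies,
   which are positive and finite with exponents affine in s, preserve this
   three-point inequality, and so do positive powers, products and finally the
   suprema.  Hoelder's inequality needs the set function [sphere_measure] to be
   a measure: [lebesgue_rV] is, by induction on n, the image of a product
   measure under (t, x) |-> row_mx t%:M x, and [sphere_measure] is n times its
   image under the radial projection. *)
From HB Require Import structures.
Require Import Defs.
From mathcomp Require Import all_boot all_order all_algebra.
From mathcomp Require Import all_classical all_reals all_analysis.
From mathcomp Require Import measurable_realfun.
From mathcomp Require Import ring lra.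
Set Implicit Arguments.
Unset Strict Implicit.
Unset Printing Implicit Defensive.
Import Order.TTheory GRing.Theory Num.Theory.
Import numFieldNormedType.Exports.
Local Open Scope classical_set_scope.
Local Open Scope ring_scope.

(** * Borel sets and Borel functions on R^n *)

Section borel_rV.
Context {R : realType} {n : nat}.
Implicit Types (A : set 'rV[R]_n).

Lemma open_measurable_rV A : open A -> measurable A.
Proof. exact: sub_gen_smallest. Qed.

Lemma closed_measurable_rV A : closed A -> measurable A.
Proof. by rewrite -openC => /open_measurable_rV/measurableC; rewrite setCK. Qed.

Lemma open_measurable_fun_rV d (T : measurableType d) (D : set T)
    (f : T -> 'rV[R]_n) :
  (forall U : set 'rV[R]_n, open U -> measurable (D `&` f @^-1` U)) ->
  measurable_fun D f.
Proof.
move=> mf; apply: (@measurability _ _ _ _ D f open) => //.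
by move=> _ [U oU <-]; exact: mf.
Qed.

Lemma gt_measurable_fun d (T : measurableType d) (D : set T) (f : T -> R) :
  (forall a, measurable (D `&` [set x | a < f x])) -> measurable_fun D f.
Proof.
move=> mf; apply: (measurability (@RGenOInfty.G R)).
  exact: RGenOInfty.measurableE.
move=> _ [_ [a ->] <-]; rewrite [X in _ X](_ : _ = D `&` [set x | a < f x])//.
by apply/seteqP; split => x /=; rewrite in_itv/= andbT.
Qed.

Lemma continuous_measurable_rV (f : 'rV[R]_n -> R) :
  continuous f -> measurable_fun setT f.
Proof.
move=> cf; apply: gt_measurable_fun => a; rewrite setTI.
apply: open_measurable_rV.
rewrite (_ : mkset _ = f @^-1` [set y | a < y]) //.
by move/continuousP : cf; apply; exact: open_gt.
Qed.

Lemma continuous_within_measurable_rV (D : set 'rV[R]_n) (f : 'rV[R]_n -> R) :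
  measurable D -> {within D, continuous f} -> measurable_fun D f.
Proof.
move=> mD /continuousP cf; apply: gt_measurable_fun => a.
have /cf/open_subspaceP[V oV VD] : open [set y : R | a < y] by exact: open_gt.
rewrite setIC (_ : _ `&` D = V `&` D).
  by apply: measurableI => //; exact: open_measurable_rV.
by rewrite VD.
Qed.

End borel_rV.

(** * Measurability of prepending a coordinate *)

Section row_cons.
Context {R : realType} {n : nat}.

Definition row_cons (z : R * 'rV[R]_n) : 'rV[R]_n.+1 :=
  row_mx (z.1%:M : 'rV[R]_1) z.2.

Lemma ball_row_cons (z w : R * 'rV[R]_n) r : 0 < r ->
  ball z.1 r w.1 -> ball z.2 r w.2 -> ball (row_cons z) r (row_cons w).
Proof.
move=> r0 zw1 [_ zw2]; split=> // i j; rewrite !ord1 {i} /row_cons !mxE.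
case: splitP => k _; last exact: zw2.
by rewrite ord1 !mxE !eqxx !mulr1n.
Qed.

Lemma rat_ball_rV (x : 'rV[R]_n) (r : R) : 0 < r ->
  exists c : 'rV[rat]_n, ball (map_mx ratr c : 'rV[R]_n) r x.
Proof.
move=> r0.
have h (j : 'I_n) : exists q : rat, ball (ratr q : R) r (x 0 j).
  have [|q] := @rat_in_itvoo R (x 0 j - r) (x 0 j + r).
    by rewrite ltrBlDr -addrA ltrDl addr_gt0.
  rewrite in_itv/= => /andP[q1 q2]; exists q; apply: ball_sym.
  by rewrite ball_itv /= in_itv/= q1.
have [c hc] := choice h.
by exists (\row_j c j); split=> // i j; rewrite ord1 !mxE.
Qed.

(* An open set is a countable union of rational boxes, hence belongs to the
   product sigma-algebra. *)
Lemma measurable_row_cons : measurable_fun setT row_cons.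
Proof.
apply: open_measurable_fun_rV => U oU; rewrite setTI.
pose box (q : rat * 'rV[rat]_n * rat) : set (R * 'rV[R]_n) :=
  ball (ratr q.1.1 : R) (ratr q.2 : R) `*`
  ball (map_mx ratr q.1.2 : 'rV[R]_n) (ratr q.2 : R).
pose P q := box q `<=` row_cons @^-1` U.
rewrite (_ : _ @^-1` _ = \bigcup_q (if `[< P q >] then box q else set0)).
  apply: countable_bigcupT_measurable; first exact: countableP.
  move=> q; case: ifP => _; last exact: measurable0.
  apply: measurableX; first by apply: open_measurable; exact: ball_open.
  by apply: open_measurable_rV; exact: ball_open.
apply/seteqP; split => [z Uz|z [q _]]; last first.
  by case: ifPn => // /asboolP Pq /Pq.
have [e /= e0 eU] : \forall e \near 0^'+, ball (row_cons z) e `<=` U.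
  exact: open_subball.
(* [eU] covers only radii strictly below [e], hence the ball of radius [e / 2]. *)
have e2 : 0 < e / 2 by rewrite divr_gt0.
have zU : ball (row_cons z) (e / 2) `<=` U.
  apply: eU => //=; rewrite sub0r normrN gtr0_norm// ltr_pdivrMr//.
  by rewrite ltr_pMr// ltr1n.
(* The triangle inequality doubles the radius, so a box of radius below [e / 4] that contains [z]
   stays within [e / 2] of [z]. *)
have [q] := @rat_in_itvoo R 0 (e / 4) (divr_gt0 e0 (ltr0n _ 4)).
rewrite in_itv/= => /andP[q0 qe].
have [c2 zc2] := rat_ball_rV z.2 q0.
have [c1] := @rat_in_itvoo R (z.1 - ratr q) (z.1 + ratr q)
  ltac:(by rewrite ltrBlDr -addrA ltrDl addr_gt0).
rewrite in_itv/= => /andP[zc1 zc1'].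
have bc1 : ball (ratr c1 : R) (ratr q) z.1.
  by apply: ball_sym; rewrite ball_itv/= in_itv/= zc1.
exists (c1, c2, q) => //; rewrite ifT//; apply/asboolP => w [/= w1 w2].
apply: zU; apply: (@le_ball _ _ _ (ratr q + ratr q)).
  by rewrite (_ : e / 2 = e / 4 + e / 4) ?lerD ?ltW//; field.
apply: ball_row_cons; first exact: addr_gt0.
- exact: ball_triangle (ball_sym bc1) w1.
- exact: ball_triangle (ball_sym zc2) w2.
Qed.

End row_cons.

(** * Images of measures that are sigma-finite *)

Section pushforward_sigma_finite.
Local Open Scope ereal_scope.
Context d d' (T : measurableType d) (T' : measurableType d') (R : realType).
Variables (m : {measure set T -> \bar R}) (f : T -> T').
Hypothesis mf : measurable_fun setT f.
Hypothesis sf : sigma_finite setT (pushforward m f).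

Let nu := pushforward m f.

Let nu_sigma_additive : semi_sigma_additive nu.
Proof.
move=> F mF tF mUF; rewrite /nu /pushforward preimage_bigcup.
apply: measure_semi_sigma_additive.
- by move=> n; rewrite -[X in measurable X]setTI; exact: mf.
- apply/trivIsetP => /= i j _ _ ij; rewrite -preimage_setI.
  by move/trivIsetP : tF => /(_ _ _ _ _ ij) ->//; rewrite preimage_set0.
- by rewrite -preimage_bigcup -[X in measurable X]setTI; exact: mf.
Qed.

HB.instance Definition _ := isMeasure.Build _ _ _ nu
  (measure0 m) (fun A => measure_ge0 m (f @^-1` A)) nu_sigma_additive.
HB.instance Definition _ := Measure_isSigmaFinite.Build _ _ _ nu sf.

Lemma pushforward_sigma_finite_measure :
  exists mu : {sigma_finite_measure set T' -> \bar R},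
    mu = pushforward m f :> (set T' -> \bar R).
Proof. by exists nu. Qed.

End pushforward_sigma_finite.

(** * Lebesgue measure on R^n as a measure *)

Section lebesgue_rV_measure.
Context {R : realType}.
Local Open Scope ereal_scope.

Lemma ball0_rVP n (r : R) (x : 'rV[R]_n) : (0 < r)%R ->
  ball (0%R : 'rV[R]_n) r x <-> forall i, (`|x 0%R i| < r)%R.
Proof.
move=> r0; split=> [[_ xr] i|xr].
  by have := xr 0%R i; rewrite mxE /ball/= sub0r normrN.
by split=> // i j; rewrite ord1 mxE /ball/= sub0r normrN.
Qed.

(** Library balls of row vectors are cubes of the sup norm, hence products, so that every section is
    a cube or empty. *)
Lemma ball_row_mx n (r : R) t : (0 < r)%R ->
  [set x | ball (0%R : 'rV[R]_n.+1) r (row_mx (t%:M : 'rV[R]_1) x)] =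
  if (`|t| < r)%R then ball (0%R : 'rV[R]_n) r else set0.
Proof.
move=> r0; case: ifPn => tr; apply/seteqP; split => x //=;
  rewrite ?ball0_rVP// => xr.
- by move=> i; have := xr (rshift 1 i); rewrite (@row_mxEr _ 1 1 n).
- move=> i; case: (@split_ordP 1 n i) => k ->;
    last by rewrite (@row_mxEr _ 1 1 n).
  by rewrite (@row_mxEl _ 1 1 n) ord1 !mxE eqxx mulr1n.
- by move/negP : tr; apply; have := xr (lshift n (ord0 : 'I_1));
    rewrite (@row_mxEl _ 1 1 n) !mxE eqxx mulr1n.
Qed.

Lemma lebesgue_rV_set0 n : @lebesgue_rV R n set0 = 0.
Proof.
elim: n => [|n IH] /=; first by rewrite diracE in_set0.
by apply: integral0_eq => t _; rewrite -[RHS]IH.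
Qed.

Lemma lebesgue_rV_ball n (r : R) : (0 < r)%R ->
  lebesgue_rV (ball (0%R : 'rV[R]_n) r) = ((r *+ 2) ^+ n)%:E.
Proof.
move=> r0; elim: n => [|n IH].
  by rewrite /= diracE mem_set//; exact: ballxx.
rewrite /=.
transitivity (\int[lebesgue_measure]_(t in `](- r)%R, r[)
  cst ((r *+ 2) ^+ n)%:E t).
  rewrite [RHS]integral_mkcond; apply: eq_integral => t _.
  rewrite ball_row_mx// patchE /= mem_setE in_itv/= -ltr_norml.
  by case: ifP => _; rewrite ?IH// lebesgue_rV_set0.
rewrite integral_cst//= lebesgue_measure_itv/= lte_fin gtrN//.
by rewrite -EFinD -EFinM opprK -mulr2n exprSr.
Qed.

Lemma lebesgue_rV_ge0 n (A : set 'rV[R]_n) : 0 <= lebesgue_rV A.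
Proof.
elim: n A => [|n IH] A; first exact: measure_ge0.
by apply: integral_ge0 => t _; exact: IH.
Qed.

Lemma lebesgue_rV_sigma_finite n : sigma_finite setT (@lebesgue_rV R n).
Proof.
exists (fun k => ball (0%R : 'rV[R]_n) k.+1%:R).
  apply/esym; rewrite -subTset => x _; exists (Num.truncn `|x|%R) => //.
  by rewrite -ball_normE/= sub0r normrN truncnS_gt.
move=> k; split; first by apply: open_measurable_rV; exact: ball_open.
by rewrite lebesgue_rV_ball ?ltr0n// ltry.
Qed.

(** Sigma-finiteness belongs to the induction hypothesis because the product with [lebesgue_measure]
    requires it of [mu]. In the next dimension it comes from [lebesgue_rV_sigma_finite], by
    exhaustion with cubes. *)
Lemma lebesgue_rV_is_measure n :
  exists mu : {sigma_finite_measure set 'rV[R]_n -> \bar R},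
    mu = @lebesgue_rV R n :> (set 'rV[R]_n -> \bar R).
Proof.
elim: n => [|n [mu muE]].
  by exists (dirac (0%R : 'rV[R]_0)).
have nuE : pushforward (lebesgue_measure \x mu) (@row_cons R n) =
    @lebesgue_rV R n.+1.
  apply/funext => A; rewrite /pushforward /product_measure1 /= -muE.
  apply: eq_integral => t _ /=; congr (mu _).
  by apply/seteqP; split => x; rewrite /xsection/= inE.
have := @lebesgue_rV_sigma_finite n.+1; rewrite -nuE.
by apply: pushforward_sigma_finite_measure; exact: measurable_row_cons.
Qed.

Lemma lebesgue_rV_sigma_additive n : semi_sigma_additive (@lebesgue_rV R n).
Proof.
have [mu <-] := lebesgue_rV_is_measure n.
exact: measure_semi_sigma_additive.
Qed.

HB.instance Definition _ n := isMeasure.Build _ _ _ (@lebesgue_rV R n)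
  (lebesgue_rV_set0 n) (@lebesgue_rV_ge0 n) (@lebesgue_rV_sigma_additive n).

End lebesgue_rV_measure.

(** * Euclidean norm and spherical measure *)

Section euclidean_theory.
Context {R : realType} {n : nat}.
Implicit Types (x y u : 'rV[R]_n).

Lemma edotC x y : edot x y = edot y x.
Proof. by apply: eq_bigr => i _; rewrite mulrC. Qed.

Lemma edotZl a x y : edot (a *: x) y = a * edot x y.
Proof. by rewrite mulr_sumr; apply: eq_bigr => i _; rewrite mxE mulrA. Qed.

Lemma edot_ge0 x : 0 <= edot x x.
Proof. by apply: sumr_ge0 => i _; rewrite -expr2 sqr_ge0. Qed.

Lemma edotxx x : edot x x = enorm x ^+ 2.
Proof. by rewrite sqr_sqrtr// edot_ge0. Qed.

Lemma enormZ a x : enorm (a *: x) = `|a| * enorm x.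
Proof.
by rewrite /enorm edotZl edotC edotZl mulrA -expr2 sqrtrM ?sqr_ge0// sqrtr_sqr.
Qed.

Lemma continuous_edot y : continuous (fun x => edot x y).
Proof.
apply: continuous_big => [|i _ x]; first exact: add_continuous.
by apply: continuousM; [exact: coord_continuous|exact: cst_continuous].
Qed.

Lemma continuous_enorm : continuous (@enorm R n).
Proof.
move=> x; apply: continuous_comp; last exact: sqrt_continuous.
apply: continuous_big => [|i _ {}x]; first exact: add_continuous.
by apply: continuousM; exact: coord_continuous.
Qed.

Lemma measurable_esphere : measurable (@esphere R n).
Proof.
apply: closed_measurable_rV.
by apply: (@closed_comp _ _ (@enorm R n) [set 1]) => [x _|];
  [exact: continuous_enorm|exact: closed_eq].
Qed.

(** A crude estimate in place of Cauchy-Schwarz, suited to library balls, which bound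
    coordinates. *)
Lemma edot_le a b x y :
  (forall i, `|x 0 i| <= a) -> (forall i, `|y 0 i| <= b) ->
  `|edot x y| <= n%:R * (a * b).
Proof.
move=> xa yb; rewrite (le_trans (ler_norm_sum _ _ _))//.
rewrite mulr_natl -[X in _ *+ X]card_ord -sumr_const.
by apply: ler_sum => i _; rewrite normrM ler_pM.
Qed.

Lemma coord_le_enorm x i : `|x 0 i| <= enorm x.
Proof.
rewrite -sqrtr_sqr ler_wsqrtr// /edot (bigD1 i)//= expr2 lerDl.
by apply: sumr_ge0 => j _; rewrite -expr2 sqr_ge0.
Qed.

Local Open Scope ereal_scope.

Definition radial_set (A : set 'rV[R]_n) : set 'rV[R]_n :=
  [set x | (0 < enorm x <= 1)%R /\ A ((enorm x)^-1 *: x)%R].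

(** The set measured inside [sphere_measure] is a preimage under the radial projection, which is
    continuous away from the origin. *)
Lemma measurable_radial_set A : measurable A -> measurable (radial_set A).
Proof.
move=> mA.
have mD : measurable [set x : 'rV[R]_n | (0 < enorm x <= 1)%R].
  have me := continuous_measurable_rV continuous_enorm.
  rewrite [X in measurable X](_ : _ = setT `&` @enorm R n @^-1` `]0%R, 1%R]).
    exact: me.
  by apply/seteqP; split => x /=; rewrite in_itv/=; [|case].
suff mf : measurable_fun [set x : 'rV[R]_n | (0 < enorm x <= 1)%R]
    (fun x : 'rV[R]_n => ((enorm x)^-1 *: x)%R).
  exact: mf.
apply: open_measurable_fun_rV => U oU.
(* Without the bound [enorm x <= 1] the set is open: near each of its points the norm stays positive
   and the projection is continuous. *)
pose V := [set x : 'rV[R]_n | (0 < enorm x)%R /\ U ((enorm x)^-1 *: x)%R].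
rewrite [X in measurable X]
  (_ : _ = [set x : 'rV[R]_n | (0 < enorm x <= 1)%R] `&` V).
  apply: measurableI => //; apply: open_measurable_rV.
  rewrite openE => x [x0 Ux].
  have : \forall y \near x, (0 < enorm y)%R.
    exact: (cvgr_gt _ (@continuous_enorm x)).
  have : \forall y \near x, U ((enorm y)^-1 *: y)%R.
    have : {for x, continuous (fun y : 'rV[R]_n => ((enorm y)^-1 *: y)%R)}.
      apply: continuousZ => //; apply: continuousV; first by rewrite gt_eqF.
      exact: continuous_enorm.
    by apply; exact: open_nbhs_nbhs.
  by apply: filterS2 => y Uy y0; split.
by apply/seteqP; split => x /= [x01]; [move=> Ux; case/andP: (x01)|case].
Qed.

Lemma sphere_measure_set0 : @sphere_measure R n set0 = 0.
Proof.
rewrite /sphere_measure (_ : mkset _ = set0) ?measure0 ?mule0//.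
by apply/seteqP; split => x // [].
Qed.

Lemma sphere_measure_ge0 (A : set 'rV[R]_n) : 0 <= sphere_measure A.
Proof. by rewrite mule_ge0// measure_ge0. Qed.

Lemma sphere_measure_sigma_additive : semi_sigma_additive (@sphere_measure R n).
Proof.
move=> F mF tF mUF.
have mR k : measurable (radial_set (F k)) by exact: measurable_radial_set.
have UE : radial_set (\bigcup_k F k) = \bigcup_k radial_set (F k).
  apply/seteqP; split => x /=; first by move=> [? [k _ Fk]]; exists k.
  by move=> [k _ []] ? ?; split => //; exists k.
have tR : trivIset setT (radial_set \o F).
  apply/trivIsetP => /= i j _ _ ij.
  move/trivIsetP : tF => /(_ i j Logic.I Logic.I ij) F0.
  apply/seteqP; split => x //= [[_ Fi] [_ Fj]].
  by have : (F i `&` F j) ((enorm x)^-1 *: x)%R by []; rewrite F0.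
(* On radial sets [sphere_measure] unfolds to the scaled Lebesgue measure, whose additivity is
   applied to the disjoint sets [radial_set (F k)]. *)
have := @measure_semi_sigma_additive _ _ _
  (mscale (NngNum (ler0n R n)) (@lebesgue_rV R n)) _ mR tR.
rewrite -UE => /(_ (measurable_radial_set mUF)); exact.
Qed.

HB.instance Definition _ := isMeasure.Build _ _ _ (@sphere_measure R n)
  sphere_measure_set0 sphere_measure_ge0 sphere_measure_sigma_additive.

End euclidean_theory.

(** * Three-point log-convexity in the extended reals *)

Section log_interpolation.
Context {R : realType}.
Local Open Scope ereal_scope.
Implicit Types (a b r : R) (x y z : \bar R) (X Y Z : set \bar R).

Lemma le_poweR r x y : (0 <= r)%R -> 0 <= x -> x <= y -> x `^ r <= y `^ r.
Proof.
move=> r0 x0 xy; apply: gt0_ler_poweR; rewrite // in_itv/= leey andbT//.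
exact: le_trans xy.
Qed.

(* For positive numbers: log x is at most the average of log y and log z with
   weights proportional to a and b. *)
Definition log_interp a b x y z : Prop :=
  [/\ 0 <= x, 0 <= y, 0 <= z & x `^ (a + b) <= y `^ a * z `^ b].

(** For the factors that do not depend on the index. *)
Lemma log_interp_refl a b x : (0 < a)%R -> (0 < b)%R -> 0 <= x ->
  log_interp a b x x x.
Proof.
move=> a0 b0 x0; split=> //; rewrite -poweRD//.
by apply: add_neq0_poweRD_def; rewrite gt_eqF// addr_gt0.
Qed.

Lemma log_interpM a b x y z x' y' z' : log_interp a b x y z ->
  log_interp a b x' y' z' -> log_interp a b (x * x') (y * y') (z * z').
Proof.
move=> [x0 y0 z0 xyz] [x'0 y'0 z'0 xyz']; split; rewrite ?mule_ge0//.
by rewrite !poweRM// muleACA lee_pmul ?poweR_ge0.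
Qed.

Lemma log_interp_poweR a b r x y z : (0 <= r)%R -> log_interp a b x y z ->
  log_interp a b (x `^ r) (y `^ r) (z `^ r).
Proof.
move=> r0 [x0 y0 z0 xyz]; split; rewrite ?poweR_ge0//.
rewrite poweRAC (poweRAC y) (poweRAC z) -poweRM ?poweR_ge0//.
by rewrite le_poweR ?poweR_ge0.
Qed.

(** Equality holds: [v] is positive and finite, so exponents of either sign add up. *)
Lemma log_interp_exponent a b (v s t u : R) : (0 < v)%R ->
  (s * (a + b) = t * a + u * b)%R ->
  log_interp a b (v%:E `^ s) (v%:E `^ t) (v%:E `^ u).
Proof.
move=> v0 stu; split; rewrite ?poweR_ge0//.
rewrite -!poweRrM stu !poweR_EFin -EFinM lee_fin powRD// (gt_eqF v0).
by rewrite implybT.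
Qed.

(** Each member of [X] is bounded through its own pair in [Y] and [Z], and that pair lies below the
    two suprema; the resulting bound [B] is the same for all members. *)
Lemma log_interp_ereal_sup a b X Y Z : (0 < a)%R -> (0 < b)%R ->
  (forall x, X x -> exists y z, [/\ Y y, Z z & log_interp a b x y z]) ->
  ereal_sup X `^ (a + b) <= ereal_sup Y `^ a * ereal_sup Z `^ b.
Proof.
move=> a0 b0 XYZ; have ab0 : (0 < a + b)%R by rewrite addr_gt0.
set B := (X in _ <= X); have B0 : 0 <= B by rewrite mule_ge0// poweR_ge0.
have XB x : X x -> x `^ (a + b) <= B.
  move=> /XYZ[y [z [Yy Zz [_ y0 z0 /le_trans]]]]; apply.
  have yY := ereal_sup_ubound Yy; have zZ := ereal_sup_ubound Zz.
  by rewrite lee_pmul ?poweR_ge0// le_poweR// ltW.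
(* The root of [B] bounds [X] itself, so the power never has to be exchanged with the supremum. *)
have : ereal_sup X <= B `^ (a + b)^-1.
  apply: ge_ereal_sup => x Xx; have [y [z [_ _ [x0 _ _ _]]]] := XYZ x Xx.
  rewrite -[x]poweRe1// -(@mulfV _ (a + b)%R) ?gt_eqF// poweRrM.
  by rewrite le_poweR ?invr_ge0 ?(ltW ab0) ?poweR_ge0// XB.
have [sX0 sXB|sX0 _] := leP 0 (ereal_sup X); last first.
  (* A negative supremum occurs only for empty [X]; a nonzero power of [-oo] is 0 by convention. *)
  have -> : ereal_sup X = -oo.
    apply/eqP; rewrite -leeNy_eq; apply: ge_ereal_sup => x Xx.
    have [y [z [_ _ [x0 _ _ _]]]] := XYZ x Xx.
    by have := le_lt_trans (le_trans x0 (ereal_sup_ubound Xx)) sX0;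
      rewrite ltxx.
  by rewrite poweRNyr ?gt_eqF.
rewrite -[B]poweRe1// -(@mulVf _ (a + b)%R) ?gt_eqF// poweRrM.
by rewrite le_poweR// ltW.
Qed.

End log_interpolation.

(** * Hoelder's inequality and weighted integrals *)

Section weighted_integral.
Local Open Scope ereal_scope.
Context d (T : measurableType d) (R : realType).
Variables (mu : {measure set T -> \bar R}) (D : set T).
Hypothesis mD : measurable D.

Lemma measurable_fun_powR (f : T -> R) (r : R) :
  measurable_fun D f -> measurable_fun D (fun x => f x `^ r)%R.
Proof. exact: (measurableT_comp (measurable_powR r)). Qed.

(** Hoelder's inequality with conjugate exponents [(a + b) / a] and [(a + b) / b], raised to the
    power [a + b]. *)
Lemma log_interp_integral (a b : R) (f g : T -> R) :
  (0 < a)%R -> (0 < b)%R ->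
  measurable_fun D f -> measurable_fun D g ->
  (forall x, D x -> (0 <= f x)%R) -> (forall x, D x -> (0 <= g x)%R) ->
  log_interp a b
    (\int[mu]_(x in D) (f x `^ (a / (a + b)) * g x `^ (b / (a + b)))%R%:E)
    (\int[mu]_(x in D) (f x)%:E) (\int[mu]_(x in D) (g x)%:E).
Proof.
move=> a0 b0 mf mg f0 g0; have ab0 : (0 < a + b)%R by rewrite addr_gt0.
split.
- by apply: integral_ge0 => x _; rewrite lee_fin mulr_ge0 ?powR_ge0.
- by apply: integral_ge0 => x Dx; rewrite lee_fin f0.
- by apply: integral_ge0 => x Dx; rewrite lee_fin g0.
(* Extension by zero off [D] turns the integrals over [D] into integrals over the whole space. *)
pose F := (fun x => f x `^ (a / (a + b)))%R \_ D.
pose G := (fun x => g x `^ (b / (a + b)))%R \_ D.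
have mF : measurable_fun setT F.
  by apply/(measurable_restrictT _ mD); exact: measurable_fun_powR.
have mG : measurable_fun setT G.
  by apply/(measurable_restrictT _ mD); exact: measurable_fun_powR.
have := @hoelder _ _ _ mu F G ((a + b) / a) ((a + b) / b) mF mG.
rewrite !divr_gt0// !invf_div -mulrDl divff ?gt_eqF// => /(_ isT isT erefl).
rewrite Lnorm1.
have -> : \int[mu]_x `|(F \* G)%R x|%:E =
    \int[mu]_(x in D) (f x `^ (a / (a + b)) * g x `^ (b / (a + b)))%R%:E.
  rewrite [RHS]integral_mkcond; apply: eq_integral => x _.
  rewrite /F /G /= !patchE; case: ifP => _; last by rewrite mul0r normr0.
  by rewrite ger0_norm// mulr_ge0 ?powR_ge0.
(* On [D] the power in the norm cancels [c / (a + b)]; off [D], zero to a nonzero power is zero. *)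
have N (c : R) (h : T -> R) : (0 < c)%R -> (forall x, D x -> (0 <= h x)%R) ->
    'N[mu]_((a + b) / c)%:E[EFin \o ((fun x => h x `^ (c / (a + b)))%R \_ D)] =
    (\int[mu]_(x in D) (h x)%:E) `^ (c / (a + b)).
  move=> c0 h0; rewrite unlock invf_div; congr (_ `^ _).
  rewrite [RHS]integral_mkcond; apply: eq_integral => x _ /=.
  rewrite !patchE; case: ifPn => [/set_mem Dx|_].
    rewrite ger0_norm ?powR_ge0// -powRrM mulrA divfK ?gt_eqF//.
    by rewrite divff ?gt_eqF// powRr1// h0.
  by rewrite normr0 powR0// gt_eqF// divr_gt0.
rewrite /F /G !N//.
set I := (X in X <= _) => IFG.
have ac (c : R) : (c = c / (a + b) * (a + b))%R by rewrite divfK// gt_eqF.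
rewrite [in X in _ * X](ac b) [in X in X * _](ac a).
rewrite (poweRrM _ (a / _)%R) (poweRrM _ (b / _)%R) -poweRM ?poweR_ge0//.
apply: le_poweR IFG; first exact: ltW.
by apply: integral_ge0 => x _; rewrite lee_fin mulr_ge0 ?powR_ge0.
Qed.

(** The exponents are affine in the index, so the integrand at [j] is pointwise a weighted geometric
    mean of those at [i] and [k]. *)
Lemma log_interp_weighted_integral (c i j k : R) (A B : T -> R) : (0 < c)%R ->
  (i < j)%R -> (j < k)%R ->
  measurable_fun D A -> measurable_fun D B ->
  (forall x, D x -> (0 < A x)%R) -> (forall x, D x -> (0 < B x)%R) ->
  let I s := \int[mu]_(x in D) (A x `^ ((c - s) / c) * B x `^ (s / c))%R%:E in
  log_interp (k - j) (j - i) (I j) (I i) (I k).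
Proof.
move=> c0 ij jk mA mB A0 B0 I.
pose w s x := (A x `^ ((c - s) / c) * B x `^ (s / c))%R.
have mw s : measurable_fun D (w s).
  by apply: measurable_funM; exact: measurable_fun_powR.
have w0 s x : D x -> (0 <= w s x)%R by rewrite mulr_ge0 ?powR_ge0.
have kj : (0 < k - j)%R by rewrite subr_gt0.
have ji : (0 < j - i)%R by rewrite subr_gt0.
have := log_interp_integral kj ji (mw i) (mw k) (w0 i) (w0 k).
suff -> : I j = \int[mu]_(x in D) (w i x `^ ((k - j) / (k - j + (j - i))) *
    w k x `^ ((j - i) / (k - j + (j - i))))%R%:E by [].
apply: eq_integral => x /set_mem Dx.
congr EFin; rewrite /w !powRM ?powR_ge0// mulrACA -!powRrM.
(* Positivity lets exponents of opposite signs be added; at 0 this can fail. *)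
have Ax := A0 x Dx; have Bx := B0 x Dx.
have ki : (k - j + (j - i) != 0)%R by rewrite gt_eqF// addr_gt0.
have c0' : c != 0%R by rewrite gt_eqF.
rewrite -!powRD ?(gt_eqF Ax) ?(gt_eqF Bx) ?implybT//.
by congr (_ `^ _ * _ `^ _)%R; field; rewrite ki c0'.
Qed.

End weighted_integral.

(** * Support functions, curvature functions and polar bodies *)

Section bodies.
Context {R : realType} {n : nat}.
Implicit Types (K L Q : set 'rV[R]_n) (x y u : 'rV[R]_n).

(* All that is used of a convex body; it also holds of [eball], for which no
   density of the surface area measure is needed. *)
Definition fat_bounded K : Prop :=
  (exists2 r, 0 < r & ball (0 : 'rV[R]_n) r `<=` K) /\
  (exists2 M, 0 < M & K `<=` ball (0 : 'rV[R]_n) M).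

Lemma convex_body0_fat_bounded K : convex_body0 K -> fat_bounded K.
Proof.
move=> [_ cK K0]; split.
  have /nbhs_ballP[r r0 rK] : nbhs (0 : 'rV[R]_n) K by [].
  by exists r.
have /compact_bounded/ex_strict_bound_gt0[M /= M0 KM] := cK.
by exists M => // x /KM; rewrite -ball_normE/= sub0r normrN.
Qed.

Lemma eball_fat_bounded : fat_bounded eball.
Proof.
split.
  (* On this cube [edot x x] is at most [n / n.+1 ^ 2]; [n.+1] also keeps the radius positive in
     dimension 0. *)
  exists n.+1%:R^-1; first by rewrite invr_gt0.
  move=> x; rewrite ball0_rVP ?invr_gt0// => xn.
  rewrite /eball/= /enorm -[leRHS]sqrtr1 ler_wsqrtr//.
  have := @edot_le _ _ _ _ x x (fun i => ltW (xn i)) (fun i => ltW (xn i)).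
  rewrite (ger0_norm (edot_ge0 x)) => /le_trans; apply.
  rewrite mulrA mulr_ile1 ?invf_le1 ?ler1n// ?mulr_ge0 ?invr_ge0//.
  by rewrite ler_pdivrMr// mul1r ler_nat.
(* Any radius above 1 would do: library balls are open, [eball] is closed. *)
exists 2 => // x /= x1; rewrite ball0_rVP// => i.
by rewrite (le_lt_trans (coord_le_enorm x i))// (le_lt_trans x1)// ltr1n.
Qed.

Lemma support_fun_has_ubound K u : fat_bounded K ->
  has_ubound [set edot x u | x in K].
Proof.
move=> [_ [M M0 KM]]; exists (n%:R * (M * enorm u)) => _ [x /KM xM <-].
rewrite (le_trans (ler_norm _))// edot_le// => i; last exact: coord_le_enorm.
by move: xM; rewrite ball0_rVP// => /(_ i)/ltW.
Qed.

(** The point [r / 2 *: u] lies in the body and pairs with [u] to [r / 2]. *)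
Lemma support_fun_gt0 K u : fat_bounded K -> esphere u -> 0 < support_fun K u.
Proof.
move=> bK u1; have [[r r0 rK] _] := bK.
apply: (@lt_le_trans _ _ (edot (r / 2 *: u) u)).
  by rewrite edotZl edotxx u1 expr1n mulr1 divr_gt0.
apply: ub_le_sup; first exact: support_fun_has_ubound.
exists (r / 2 *: u) => //; apply: rK; rewrite ball0_rVP// => i.
rewrite (le_lt_trans (coord_le_enorm _ i))// enormZ u1 mulr1.
by rewrite gtr0_norm ?divr_gt0// ltr_pdivrMr// ltr_pMr// ltr1n.
Qed.

(** A supremum of linear functions is lower semicontinuous: its strict superlevel sets are unions of
    open sets, one for each point of the body. *)
Lemma measurable_support_fun K : fat_bounded K ->
  measurable_fun setT (support_fun K).
Proof.
move=> bK; apply: gt_measurable_fun => a; rewrite setTI.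
apply: open_measurable_rV.
rewrite (_ : mkset _ = \bigcup_(x in K) [set u | a < edot x u]).
  apply: bigcup_open => x _.
  rewrite (_ : mkset _ = (fun u => edot u x) @^-1` [set y | a < y]).
    by have /continuousP := @continuous_edot R n x; apply; exact: open_gt.
  by apply/seteqP; split => u /=; rewrite edotC.
apply/seteqP; split => u /=; last first.
  move=> [x Kx /= /lt_le_trans]; apply; apply: ub_le_sup; last by exists x.
  exact: support_fun_has_ubound.
have [[r r0 rK] _] := bK.
move=> /sup_gt[|_ [x Kx <-] ax]; last by exists x.
by exists (edot 0 u), 0 => //; apply: rK; exact: ballxx.
Qed.

(** The junk value 1 is positive too, so [eball] is covered. *)
Lemma curvature_fun_gt0 K u : esphere u -> 0 < curvature_fun K u.
Proof.
by rewrite /curvature_fun; case: xgetP => [f _ [_ f0 _] /f0|_ _]; rewrite ?ltr01.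
Qed.

Lemma measurable_curvature_fun K :
  measurable_fun (@esphere R n) (curvature_fun K).
Proof.
rewrite /curvature_fun; case: xgetP => [f _ [cf _ _]|_].
  by apply: continuous_within_measurable_rV => //; exact: measurable_esphere.
exact: measurable_cst.
Qed.

Lemma closed_polar K : closed (polar K).
Proof.
rewrite (_ : polar K = \bigcap_(y in K)
    (fun x => edot x y) @^-1` [set t | t <= 1]).
  apply: closed_bigI => y _.
  by have /continuous_closedP := @continuous_edot R n y; apply; exact: closed_le.
by apply/seteqP; split => x /=.
Qed.

(* In [G2] the exponents of these volumes change sign with the index, and
   `^ takes junk values at 0 and +oo for negative exponents. *)
Lemma lebesgue_polar_gt0_fin K : fat_bounded K ->
  exists2 v : R, 0 < v & lebesgue_rV (polar K) = v%:E.
Proof.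
move=> [[r r0 rK] [M M0 KM]].
have mP : measurable (polar K).
  by apply: closed_measurable_rV; exact: closed_polar.
(* With coordinates below [s] and [M], [edot_le] gives the bound [n / n.+1], which is at most 1. *)
pose s := (n.+1%:R * M)^-1; have s0 : 0 < s by rewrite invr_gt0 mulr_gt0.
have sP : ball (0 : 'rV[R]_n) s `<=` polar K.
  move=> x; rewrite ball0_rVP// => xs y /KM; rewrite ball0_rVP// => yM.
  rewrite (le_trans (ler_norm _))//.
  rewrite (le_trans (edot_le (fun i => ltW (xs i)) (fun i => ltW (yM i))))//.
  rewrite /s invfM -mulrA mulVf ?gt_eqF// mulr1 ler_pdivrMr// mul1r.
  by rewrite ler_nat.
(* Pairing [x] with its positive multiple of norm [r / 2] gives [enorm x <= 2 / r]; the constant 3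
   leaves room for the strict inequality of an open ball. *)
have Pr : polar K `<=` ball (0 : 'rV[R]_n) (3 / r).
  move=> x Px; rewrite ball0_rVP ?divr_gt0// => i.
  rewrite (le_lt_trans (coord_le_enorm x i))//.
  have [x0|x0] := leP (enorm x) 0; first by rewrite (le_lt_trans x0)// divr_gt0.
  have Ky : K (r / 2 / enorm x *: x).
    apply: rK; rewrite ball0_rVP// => k.
    rewrite (le_lt_trans (coord_le_enorm _ k))// enormZ gtr0_norm ?divr_gt0//.
    by rewrite divfK ?gt_eqF// ltr_pdivrMr// ltr_pMr// ltr1n.
  have := Px _ Ky; rewrite edotC edotZl edotxx expr2 mulrA divfK ?gt_eqF//.
  move=> h; rewrite ltr_pdivlMr//; lra.
have ballm t : measurable (ball (0 : 'rV[R]_n) t).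
  by apply: open_measurable_rV; exact: ball_open.
have lo : (((s *+ 2) ^+ n)%:E <= lebesgue_rV (polar K))%E.
  by rewrite -lebesgue_rV_ball// le_measure// inE.
have hi : (lebesgue_rV (polar K) <= ((3 / r *+ 2) ^+ n)%:E)%E.
  by rewrite -lebesgue_rV_ball ?divr_gt0// le_measure// inE.
have vfin : lebesgue_rV (polar K) \is a fin_num.
  by rewrite ge0_fin_numE ?lebesgue_rV_ge0// (le_lt_trans hi)// ltry.
exists (fine (lebesgue_rV (polar K))); last by rewrite fineK.
rewrite -lte_fin fineK// (lt_le_trans _ lo)// lte_fin.
by rewrite exprn_gt0// mulrn_wgt0.
Qed.

End bodies.

(** * Interpolation for mixed volumes and for the suprema *)

Section interpolation.
Context {R : realType} {n : nat}.
Variables (K L : set 'rV[R]_n) (i j k p : R).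
Hypotheses (n_gt0 : (0 < n)%N) (bK : fat_bounded K) (bL : fat_bounded L).
Hypotheses (ij : i < j) (jk : j < k) (np : - n%:R < p).
Local Open Scope ereal_scope.

Let kj : (0 < k - j)%R. Proof. by rewrite subr_gt0. Qed.
Let ji : (0 < j - i)%R. Proof. by rewrite subr_gt0. Qed.
Let n0 : (0 < n%:R :> R)%R. Proof. by rewrite ltr0n. Qed.
Let n_p0 : (0 < n%:R + p)%R. Proof. by rewrite addrC -ltrBlDr sub0r. Qed.

Let ki : (k - i = k - j + (j - i))%R. Proof. by rewrite addrA subrK. Qed.

(** The case [p = 0], common to [G1] and [G2]. *)
Lemma log_interp_G0 :
  log_interp (k - j) (j - i) (G0 j K L) (G0 i K L) (G0 k K L).
Proof.
have h (Q : set 'rV[R]_n) : fat_bounded Q ->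
    measurable_fun esphere (fun u => support_fun Q u * curvature_fun Q u)%R /\
    forall u, esphere u -> (0 < support_fun Q u * curvature_fun Q u)%R.
  move=> bQ; split=> [|u u1].
    apply: measurable_funM; last exact: measurable_curvature_fun.
    by apply: measurable_funTS; exact: measurable_support_fun.
  by rewrite mulr_gt0 ?support_fun_gt0 ?curvature_fun_gt0.
have [[mK K0] [mL L0]] := (h K bK, h L bL).
exact: (log_interp_weighted_integral _ measurable_esphere).
Qed.

Lemma log_interp_mixed_V Q1 Q2 : fat_bounded Q1 -> fat_bounded Q2 ->
  log_interp (k - j) (j - i)
    (mixed_V p j K L Q1 Q2) (mixed_V p i K L Q1 Q2) (mixed_V p k K L Q1 Q2).
Proof.
move=> b1 b2.
have h (Q K' : set 'rV[R]_n) : fat_bounded Q -> fat_bounded K' ->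
    measurable_fun esphere
      (fun u => support_fun Q u `^ p * p_curvature_fun p K' u)%R /\
    forall u, esphere u ->
      (0 < support_fun Q u `^ p * p_curvature_fun p K' u)%R.
  move=> bQ bK'; rewrite /p_curvature_fun; split=> [|u u1].
    have mpow (K'' : set 'rV[R]_n) (q : R) : fat_bounded K'' ->
        measurable_fun (@esphere R n) (fun u => support_fun K'' u `^ q)%R.
      move=> bK''; apply: measurable_fun_powR; apply: measurable_funTS.
      exact: measurable_support_fun.
    apply: measurable_funM; first exact: mpow.
    apply: measurable_funM; first exact: mpow.
    exact: measurable_curvature_fun.
  by rewrite !mulr_gt0 ?powR_gt0 ?support_fun_gt0 ?curvature_fun_gt0.
have [[mK K0] [mL L0]] := (h Q1 K b1 bK, h Q2 L b2 bL).
apply: log_interpM; first by apply: log_interp_refl; rewrite // lee_fin invr_ge0.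
exact: (log_interp_weighted_integral _ measurable_esphere).
Qed.

Let log_interp_nmixed_V Q1 Q2 : convex_body0 Q1 -> convex_body0 Q2 ->
  log_interp (k - j) (j - i)
    (n%:R%:E * mixed_V p j K L Q1 Q2 `^ (n%:R / (n%:R + p)))
    (n%:R%:E * mixed_V p i K L Q1 Q2 `^ (n%:R / (n%:R + p)))
    (n%:R%:E * mixed_V p k K L Q1 Q2 `^ (n%:R / (n%:R + p))).
Proof.
move=> b1 b2; apply: log_interpM; first exact: log_interp_refl.
(* The exponent is nonnegative because [- n < p]. *)
apply: log_interp_poweR; first by rewrite divr_ge0// ltW.
by apply: log_interp_mixed_V; exact: convex_body0_fat_bounded.
Qed.

Lemma G1_interpolation :
  G1 p j K L `^ (k - i) <= G1 p i K L `^ (k - j) * G1 p k K L `^ (j - i).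
Proof.
rewrite ki /G1; case: (p == 0%R); first by have [] := log_interp_G0.
apply: log_interp_ereal_sup => // _ [Q bQ <-].
(* The same body [Q] competes in the suprema at [i] and at [k]; its polar volume is a factor free of
   the index. *)
do 2 eexists; split; [exists Q => //|exists Q => //|].
apply: log_interpM; first exact: log_interp_nmixed_V.
by apply: log_interp_refl => //; rewrite poweR_ge0.
Qed.

(** Here the polar volumes carry exponents affine in the index, so each contributes an equality
    through [log_interp_exponent]. *)
Lemma G2_interpolation :
  G2 p j K L `^ (k - i) <= G2 p i K L `^ (k - j) * G2 p k K L `^ (j - i).
Proof.
rewrite ki /G2; case: (p == 0%R); first by have [] := log_interp_G0.
apply: log_interp_ereal_sup => // _ [Q1 [Q2 [b1 b2 ->]]].
do 2 eexists; split; [by exists Q1, Q2|by exists Q1, Q2|].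
have [v1 v10 ->] := lebesgue_polar_gt0_fin (convex_body0_fat_bounded b1).
have [v2 v20 ->] := lebesgue_polar_gt0_fin (convex_body0_fat_bounded b2).
have n_p : (n%:R * (n%:R + p) != 0)%R by rewrite mulf_neq0 ?gt_eqF.
apply: log_interpM; first apply: log_interpM; first exact: log_interp_nmixed_V.
all: apply: log_interp_exponent => //.
all: by field; rewrite !gt_eqF.
Qed.

End interpolation.

Local Open Scope ereal_scope.

Theorem theorem6p1 (R : realType) (n : nat) (K L : set 'rV[R]_n) (i j k p : R)
  (hn : (1 <= n)%N) (hK : convex_bodyF K) (hL : convex_bodyF L)
  (hij : (i < j)%R) (hjk : (j < k)%R)
  (hp : (- n%:R < p)%R) (hp0 : (p <= 0)%R) :
  (G1 p j K L `^ (k - i) <= G1 p i K L `^ (k - j) * G1 p k K L `^ (j - i) /\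
   G2 p j K L `^ (k - i) <= G2 p i K L `^ (k - j) * G2 p k K L `^ (j - i)) /\
  (G1 p j K eball `^ (k - i) <=
     G1 p i K eball `^ (k - j) * G1 p k K eball `^ (j - i) /\
   G2 p j K eball `^ (k - i) <=
     G2 p i K eball `^ (k - j) * G2 p k K eball `^ (j - i)).
Proof.
have bK := convex_body0_fat_bounded hK.1.
have bL := convex_body0_fat_bounded hL.1.
have bB := @eball_fat_bounded R n.
by split; split; [exact: G1_interpolation|exact: G2_interpolation
                 |exact: G1_interpolation|exact: G2_interpolation].
Qed.
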